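(* Let $0<\alpha<1$, let $q$ be defined by $\frac1q=1-\alpha$, let $\omega:\mathbb{Z}\to(0,\infty)$ be a discrete weight with $\omega\in\mathcal{A}(1,q)$, and put $v=\omega^q$. Then there exists a constant $C>0$ such that for every symmetric interval $S_{m,N}\subset\mathbb{Z}$ ($m\in\mathbb{Z}$, $N\in\mathbb{N}$) and every real sequence $x$ supported in $S_{m,N}$ with $\sum_{k\in S_{m,N}}|x(k)|\,\omega(k)\log^+|x(k)\omega(k)^{1-q}|<\infty$, both $$\Bigg(\sum_{k\in S_{m,N}}|M_\alpha x(k)\,\omega(k)|^q\Bigg)^{1/q}\le C\Bigg(v(S_{m,N})+\sum_{k\in S_{m,N}}|x(k)|\,\omega(k)\log^+\big|x(k)\omega(k)^{1-q}\big|\Bigg)$$ and $$\Bigg(\sum_{k\in S_{m,N}}|I_\alpha x(k)\,\omega(k)|^q\Bigg)^{1/q}\le C\Bigg(v(S_{m,N})+\sum_{k\in S_{m,N}}|x(k)|\,\omega(k)\log^+\big|x(k)\omega(k)^{1-q}\big|\Bigg)$$ hold.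
   Context: For $m\in\mathbb{Z}$ and $N\in\mathbb{N}=\{0,1,2,\dots\}$, let $S_{m,N}:=\{k\in\mathbb{Z}:|k-m|\le N\}$, with cardinality $|S_{m,N}|=2N+1$; $v(S_{m,N})=\sum_{k\in S_{m,N}}v(k)$. A discrete weight is a function $\omega:\mathbb{Z}\to(0,\infty)$. ''$x$ is supported in $S_{m,N}$'' means $x(k)=0$ for $k\notin S_{m,N}$. Weight class: $\omega\in\mathcal{A}(1,q)$ means $$\sup_{m\in\mathbb{Z},\,N\in\mathbb{N}}\Bigg(\frac1{|S_{m,N}|}\sum_{k\in S_{m,N}}\omega(k)^q\Bigg)^{1/q}\Bigg(\sup_{k\in S_{m,N}}\frac1{\omega(k)}\Bigg)<\infty.$$ Operators: for a real sequence $x$, the discrete fractional maximal operator is $M_\alpha x(m):=\sup_{N\in\mathbb{N}}\frac{1}{|S_{m,N}|^{1-\alpha}}\sum_{k\in S_{m,N}}|x(k)|$, and the discrete Riesz potential is $I_\alpha x(k):=\sum_{i\in\mathbb{Z}\setminus\{k\}}\frac{x(i)}{|k-i|^{1-\alpha}}$. $\log^+t:=\log t$ for $t>1$ and $\log^+t:=0$ for $0\le t\le1$. *)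

(* Defs.v *)
From mathcomp Require Import all_boot all_order all_algebra finmap.
From mathcomp Require Import all_classical all_reals all_analysis.
From mathcomp Require Import zify.

Set Implicit Arguments.
Unset Strict Implicit.
Unset Printing Implicit Defensive.

Import Order.TTheory GRing.Theory Num.Theory.

Local Open Scope classical_set_scope.
Local Open Scope ring_scope.

Definition window (m : int) (N : nat) : set int :=
  [set k : int | `|k - m| <= N%:Z].

Definition window_card (m : int) (N : nat) : nat := #|` fset_set (window m N)|.

Lemma windowE (m : int) (N : nat) :
  window m N = [set` [seq m - N%:Z + j%:Z | j <- iota 0 N.*2.+1]].
Proof.
apply/seteqP; split => k hk.
- have {}hk : `|k - m| <= N%:Z := hk.
  have -> : k = m - N%:Z + (absz (k - m + N%:Z))%:Z by lia.
  by apply: (map_f (fun j : nat => m - N%:Z + j%:Z)); rewrite mem_iota; lia.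
- have /mapP[j] : k \in [seq m - N%:Z + j%:Z | j <- iota 0 N.*2.+1] := hk.
  by rewrite mem_iota => hj ->; rewrite /window /mkset; lia.
Qed.

Lemma finite_window (m : int) (N : nat) : finite_set (window m N).
Proof. by rewrite windowE; exact: finite_seq. Qed.

Lemma window_cardE (m : int) (N : nat) : window_card m N = N.*2.+1.
Proof.
have s_uniq : uniq [seq m - N%:Z + j%:Z | j <- iota 0 N.*2.+1].
  by rewrite map_inj_uniq ?iota_uniq // => i j; lia.
rewrite /window_card -[RHS](size_iota 0) -(size_map (fun j : nat => m - N%:Z + j%:Z)).
apply/perm_size/uniq_perm => //.
move=> k.
rewrite in_fset_set; last exact: finite_window.
by rewrite windowE mem_setE.
Qed.

Section discrete_operators.
Context {R : realType}.
Implicit Types (w x : int -> R) (alpha q : R).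

Definition discrete_weight w : Prop := forall k, 0 < w k.

Definition supported_in x (A : set int) : Prop := forall k, ~ A k -> x k = 0.

Definition logp (t : R) : R := if 1 < t then ln t else 0.

(* All suprema are taken in [\bar R], so that they are genuine suprema even
   when the family is unbounded. *)
Definition A1_const q w : \bar R :=
  ereal_sup [set
    ((((window_card p.1 p.2)%:R^-1 * \sum_(k \in window p.1 p.2) w k `^ q)
        `^ q^-1)%:E
     * ereal_sup [set ((w k)^-1)%:E | k in window p.1 p.2])%E
    | p in [set: int * nat]].

Definition A1 q w : Prop := (A1_const q w < +oo)%E.

Definition frac_max alpha x (m : int) : \bar R :=
  ereal_sup [set
    (((window_card m N)%:R `^ (1 - alpha))^-1
     * \sum_(k \in window m N) `|x k|)%:E
    | N in [set: nat]].

Definition riesz_term alpha x (k i : int) : \bar R :=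
  (x i / (`|k - i|%:~R `^ (1 - alpha)))%:E.

(* The sum over [Z \ {k}] is the Lebesgue-type unconditional sum
   [sum of positive parts - sum of negative parts]; it is the usual sum
   whenever the series converges absolutely. *)
Definition riesz alpha x (k : int) : \bar R :=
  (\esum_(i in ~` [set k]) ((riesz_term alpha x k)^\+ i)
   - \esum_(i in ~` [set k]) ((riesz_term alpha x k)^\- i))%E.

Definition weighted_norm q w (A : set int) (T : int -> \bar R) : \bar R :=
  ((\sum_(k \in A) (`| T k * (w k)%:E | `^ q)) `^ q^-1)%E.

Definition LlogL q w (A : set int) x : R :=
  \sum_(k \in A) `|x k| * w k * logp `|x k * w k `^ (1 - q)|.

End discrete_operators.

(* Main.v *)
(* With v = w^q and x = v^alpha y, both operators are dominated by
   k |-> sum_i v_i y_i / U(k,i)^(1 - alpha), where U(k,i) is comparable to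
   |k - i| v_i. By the A(1,q) condition, U(k,i) bounds the v-measure of the
   balls of radius |k - i| around both k and i, so this is a fractional
   integral for the measure v. Let W be the v-measure of the window and
   Y = max(1, y). Where U < W / Y^(2/alpha), the factor 1/Y is absorbed by a
   slightly less singular kernel, and the contribution is pointwise at most
   C W^alpha. On the rest, Jensen's inequality reduces the L^q(v) norm to
   sums of v / U, each of which is logarithmic in Y. *)

Require Import Defs.
From mathcomp Require Import all_boot all_order all_algebra finmap.
From mathcomp Require Import all_classical all_reals all_analysis.
From mathcomp Require Import zify ring lra.

Set Implicit Arguments.
Unset Strict Implicit.
Unset Printing Implicit Defensive.

Import Order.TTheory GRing.Theory Num.Theory.

Local Open Scope classical_set_scope.
Local Open Scope ring_scope.

(** * Elementary inequalities and layer sums *)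

Section real_inequalities.
Context {R : realType}.
Implicit Types (a b d q T : R).

(** Young's inequality for the conjugate exponents [d^-1] and [(1 - d)^-1]. *)
Lemma powR_weighted_AMGM a b d : 0 <= a -> 0 <= b -> 0 < d -> d < 1 ->
  a `^ d * b `^ (1 - d) <= d * a + (1 - d) * b.
Proof.
move=> a0 b0 d0 d1.
have d'0 : 0 < 1 - d by rewrite subr_gt0.
have := @conjugate_powR R (a `^ d) (b `^ (1 - d)) d^-1 (1 - d)^-1.
rewrite !powR_ge0 !invr_gt0 d0 d'0 !invrK => /(_ isT isT isT isT).
rewrite -!powRrM !mulfV ?gt_eqF// !powRr1// mulrC => h.
have := h (subrKC _ _); rewrite [b * _]mulrC [a * _]mulrC mulrC; exact.
Qed.

(** By concavity of the power, the slope at the right endpoint is at most the secant slope. This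
    makes the singular kernel of the near part admissible in [layer_sum]. *)
Lemma powR_secant a b d : 0 <= a -> a <= b -> 0 < d -> d < 1 ->
  (b - a) * (b `^ (1 - d))^-1 <= b `^ d / d - a `^ d / d.
Proof.
move=> a0 ab d0 d1; have [b0|b0] := leP b 0.
  have -> : a = b by apply/le_anti; rewrite ab (le_trans b0).
  by rewrite !subrr mul0r.
have P0 : 0 < b `^ (1 - d) by exact: powR_gt0.
rewrite -mulrBl ler_pdivlMr// mulrAC ler_pdivrMr// [leRHS]mulrBl.
have := powR_weighted_AMGM a0 (ltW b0) d0 d1.
have -> : b `^ d * b `^ (1 - d) = b.
  by rewrite -powRD ?subrKC ?powRr1 ?ltW// oner_eq0.
lra.
Qed.

(** The logarithmic counterpart, for the far part; the shift [T] keeps the antiderivative finite at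
    0. *)
Lemma ln_secant a b T : 0 <= a -> a <= b -> 0 < T ->
  (b - a) * (b + T)^-1 <= ln (b + T) - ln (a + T).
Proof.
move=> a0 ab T0.
have aT : 0 < a + T by rewrite ltr_wpDl.
have bT : 0 < b + T by rewrite (lt_le_trans aT)// lerD2r.
have := @le_ln1Dx R ((a + T) / (b + T) - 1).
rewrite ltrBrDl subrr divr_gt0// addrC subrK => /(_ isT).
rewrite ln_div ?posrE//.
have -> : (b - a) * (b + T)^-1 = 1 - (a + T) / (b + T) by field; rewrite gt_eqF.
lra.
Qed.

(* The sum over the points of [s], grouped by their rank [d], is a lower
   Riemann-Stieltjes sum for the antiderivative [G] of [g]. *)
Lemma layer_sum (I : Type) (s : seq I) (d : I -> nat) (v : I -> R)
    (g G : R -> R) :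
  (forall i, 0 <= v i) ->
  (forall a b, 0 <= a -> a <= b -> (b - a) * g b <= G b - G a) ->
  \sum_(i <- s) v i * g (\sum_(j <- s | (d j <= d i)%N) v j) <=
    G (\sum_(i <- s) v i) - G 0.
Proof.
move=> v0 gG.
(* With the strict cutoff, [V 0] is an empty sum, while [V (d i).+1] is the sum over
   [d j <= d i]. *)
pose V n := \sum_(j <- s | (d j < n)%N) v j.
have partial n : \sum_(i <- s | (d i < n)%N) v i * g (V (d i).+1) <=
    G (V n) - G (V 0%N).
  elim: n => [|n IH]; first by rewrite big_pred0// subrr.
  have split_layer (F : I -> R) : \sum_(i <- s | (d i < n.+1)%N) F i =
      \sum_(i <- s | (d i < n)%N) F i + \sum_(i <- s | d i == n) F i.
    rewrite (bigID (fun i => (d i < n)%N))/=; congr (_ + _);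
      by apply: eq_bigl => i; lia.
  rewrite split_layer.
  (* All points of rank [n] share one value of [g], and their total mass is the increment of [V]. *)
  have -> : \sum_(i <- s | d i == n) v i * g (V (d i).+1) =
      (V n.+1 - V n) * g (V n.+1).
    rewrite {2}/V split_layer -/(V n) addrC addKr big_distrl/=.
    by apply: eq_bigr => i /eqP ->.
  have := gG (V n) (V n.+1).
  rewrite sumr_ge0// {2}/V split_layer -/(V n) lerDl sumr_ge0// => /(_ isT isT).
  lra.
have [n sn] : exists n, all (fun i => d i < n)%N s.
  elim: s {V partial} => [|i s [n sn]]; first by exists 0%N.
  exists (maxn (d i).+1 n); rewrite /= leq_maxl/=.
  by apply: sub_all sn => j jn; rewrite leq_max jn orbT.
have full (F : I -> R) : \sum_(i <- s | (d i < n)%N) F i = \sum_(i <- s) F i.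
  by rewrite -[RHS]big_filter -[LHS]big_filter filter_predT; move/all_filterP: sn => ->.
have V0 : V 0%N = 0 by rewrite /V big_pred0.
have Vn : V n = \sum_(i <- s) v i by exact: full.
by have := partial n; rewrite full V0 Vn.
Qed.

Lemma powR_Jensen (I : Type) (s : seq I) (a f : I -> R) q :
  1 < q -> (forall i, 0 <= a i) -> (forall i, 0 <= f i) ->
  0 < \sum_(i <- s) a i ->
  (\sum_(i <- s) a i * f i) `^ q <=
    (\sum_(i <- s) a i) `^ (q - 1) * \sum_(i <- s) a i * f i `^ q.
Proof.
move=> q1 a0 f0; set A := \sum_(i <- s) a i => A0.
have q0 : 0 < q by rewrite (lt_trans ltr01).
pose F := (\sum_(i <- s) a i * f i) / A.
have F0 : 0 <= F by rewrite divr_ge0 ?(ltW A0)// sumr_ge0// => i _; rewrite mulr_ge0.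
have AF : \sum_(i <- s) a i * f i = A * F by rewrite mulrC divfK ?gt_eqF.
(* Young's inequality against the weighted mean [F]. Summed over [i], the left side becomes [A]
   times the [q]-th power of [F], and a fraction [1 - q^-1] of it is absorbed from the right. *)
have young i : a i * (f i * F `^ (q - 1)) <=
    q^-1 * (a i * f i `^ q) + (1 - q^-1) * F `^ q * a i.
  have qV : q^-1 < 1 by rewrite invf_lt1.
  have := @powR_weighted_AMGM (f i `^ q) (F `^ q) q^-1 (powR_ge0 _ _) (powR_ge0 _ _).
  rewrite invr_gt0 => /(_ q0 qV).
  rewrite -!powRrM mulfV ?gt_eqF// powRr1// mulrBr mulr1 mulfV ?gt_eqF//.
  move=> /(ler_wpM2l (a0 i)) /le_trans; apply.
  by rewrite le_eqVlt; apply/orP; left; apply/eqP; ring.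
have : \sum_(i <- s) a i * (f i * F `^ (q - 1)) <=
    \sum_(i <- s) (q^-1 * (a i * f i `^ q) + (1 - q^-1) * F `^ q * a i).
  by apply: ler_sum => i _; exact: young.
rewrite big_split/= -!mulr_sumr -/A.
under eq_bigr do rewrite mulrA.
rewrite -mulr_suml AF -mulrA mulr_powRB1// => h.
have {h} : A * F `^ q <= \sum_(i <- s) a i * f i `^ q.
  rewrite -(ler_pM2l (_ : 0 < q^-1)) ?invr_gt0//; lra.
rewrite powRM ?(ltW A0)// -(mulr_powRB1 (ltW A0) q0) mulrAC.
by move=> h; rewrite [leLHS]mulrC ler_wpM2l ?powR_ge0.
Qed.

End real_inequalities.

(** * Splitting the fractional kernel *)

Section fractional_integral.
Context {R : realType}.
Implicit Types (alpha q : R).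

Lemma conjugate_exponent_gt1 alpha q : 0 < alpha -> alpha < 1 ->
  q^-1 = 1 - alpha -> 1 < q.
Proof.
move=> alpha_gt0 alpha_lt1 qE.
have q0 : 0 < q by rewrite -invr_gt0 qE subr_gt0.
by rewrite -invf_lt1// qE ltrBlDr ltrDl.
Qed.

Lemma conjugate_exponentE alpha q : 0 < alpha -> alpha < 1 ->
  q^-1 = 1 - alpha -> q * alpha = q - 1.
Proof.
move=> alpha_gt0 alpha_lt1 qE.
have q0 : q != 0 by rewrite gt_eqF// (lt_trans ltr01 (conjugate_exponent_gt1 alpha_gt0 alpha_lt1 qE)).
by apply/(mulfI (invr_neq0 q0)); rewrite mulKf// mulrBr mulVf// mulr1 qE; lra.
Qed.

(* The kernel is cut where [U] equals [W / Y `^ (2 / alpha)]: on the near part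
   the gain [1 / Y] compensates the height [y], and on the far part the
   truncation only costs a factor [ln Y]. *)
Lemma kernel_split alpha (U V V' W y Y : R) :
  0 < alpha -> alpha < 1 ->
  0 < U -> 0 <= V -> V <= U -> 0 < V' -> V' <= U -> 0 < W -> 1 <= Y ->
  0 <= y -> y <= Y ->
  y / U `^ (1 - alpha) <= W `^ (alpha / 2) / V' `^ (1 - alpha / 2)
    + Y * (2 / (V + W / Y `^ (2 / alpha))) `^ (1 - alpha).
Proof.
move=> alpha_gt0 alpha_lt1 U0 V0 VU V'0 V'U W0 Y1 y0 yY.
have Y0 : 0 < Y by exact: lt_le_trans Y1.
have a1 : 0 <= 1 - alpha by lra.
have a2 : 0 <= 1 - alpha / 2 by lra.
set T := W / _.
have T0 : 0 < T by rewrite divr_gt0// powR_gt0.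
have near0 : 0 <= W `^ (alpha / 2) / V' `^ (1 - alpha / 2).
  by rewrite divr_ge0// powR_ge0.
have far0 : 0 <= Y * (2 / (V + T)) `^ (1 - alpha).
  by rewrite mulr_ge0 ?powR_ge0// ltW.
have [UT|TU] := ltP U T.
- apply: (@le_trans _ _ (W `^ (alpha / 2) / V' `^ (1 - alpha / 2))); last by rewrite lerDl.
  have UE : (U `^ (1 - alpha))^-1 = U `^ (alpha / 2) / U `^ (1 - alpha / 2).
    rewrite -powRB; last by rewrite (gt_eqF U0) implybT.
    by rewrite -powRN; congr (_ `^ _); lra.
  rewrite UE mulrA; apply: ler_pM.
  + by rewrite mulr_ge0// powR_ge0.
  + by rewrite invr_ge0 powR_ge0.
  (* The exponent [2 / alpha] in [T] is chosen so that this power releases exactly one factor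
     [Y]. *)
  + have TE : W `^ (alpha / 2) = Y * T `^ (alpha / 2).
      rewrite powRM ?invr_ge0 ?powR_ge0 ?(ltW W0)// -powRN -powRrM.
      have -> : - (2 / alpha) * (alpha / 2) = -1 by field; rewrite gt_eqF.
      by rewrite powR_inv1 ?(ltW Y0)// mulrCA mulfV ?gt_eqF// mulr1.
    rewrite TE ler_pM ?powR_ge0//.
    by rewrite ge0_ler_powR ?nnegrE ?(ltW U0) ?(ltW T0) ?(ltW UT)//; lra.
  + rewrite lef_pV2 ?posrE ?powR_gt0//.
    by rewrite ge0_ler_powR ?nnegrE ?(ltW U0) ?(ltW V'0).
- apply: (@le_trans _ _ (Y * (2 / (V + T)) `^ (1 - alpha))); last by rewrite lerDr.
  (* Here both [V] and [T] are at most [U], so [V + T <= 2 * U]; hence the factor 2. *)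
  have VT : 0 < V + T by rewrite ltr_wpDl.
  rewrite ler_pM ?invr_ge0 ?powR_ge0//.
  rewrite -powRN -mulN1r powRrM powR_inv1 ?(ltW U0)//.
  rewrite ge0_ler_powR ?nnegrE ?invr_ge0 ?divr_ge0 ?(ltW U0) ?(ltW VT)//.
  rewrite ler_pdivlMr// ler_pdivrMl//; lra.
Qed.

(** Controls the logarithm of [(W + T) / T] left by the far layer sum: the power is at least 1, so
    adding 1 at most doubles it, and [ln 2 <= 1 <= 2 / alpha]. *)
Lemma ln_growth alpha (Y : R) : 0 < alpha -> alpha < 1 -> 1 <= Y ->
  ln (1 + Y `^ (2 / alpha)) <= 2 / alpha * (1 + ln Y).
Proof.
move=> alpha_gt0 alpha_lt1 Y1; have Y0 : 0 < Y by exact: lt_le_trans Y1.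
have b1 : 1 <= 2 / alpha by rewrite ler_pdivlMr//; lra.
have P1 : 1 <= Y `^ (2 / alpha).
  by have := ler_powR Y1 (le_trans ler01 b1); rewrite powRr0.
have P0 := lt_le_trans ltr01 P1.
apply: (@le_trans _ _ (ln (2 * Y `^ (2 / alpha)))).
  by rewrite ler_ln ?posrE; lra.
rewrite lnM ?posrE// ln_powR mulrDr mulr1 lerD2r (le_trans _ b1)//.
have := @le_ln1Dx R 1; have -> : 1 + 1 = 2 :> R by lra.
by apply; lra.
Qed.

End fractional_integral.

(** * The LlogL estimate for an abstract fractional integral *)

Section fractional_LlogL.
Context {R : realType}.
Implicit Types (alpha q : R).

Lemma powR_sum2_le (a b q : R) : 0 <= a -> 0 <= b -> 0 <= q ->
  (a + b) `^ q <= 2 `^ q * (a `^ q + b `^ q).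
Proof.
move=> a0 b0 q0.
wlog ab : a b a0 b0 / a <= b.
  by move=> H; have [/H|/ltW/H] := leP a b; [exact|rewrite addrC [b `^ q + _]addrC; exact].
apply: (@le_trans _ _ ((2 * b) `^ q)).
  by rewrite ge0_ler_powR ?nnegrE ?addr_ge0 ?mulr_ge0//; lra.
by rewrite powRM// ler_wpM2l ?powR_ge0// lerDr powR_ge0.
Qed.

(** Jensen is applied with weights [a k = v k * Y k * L k], whose sum is the right-hand functional.
    For fixed [k], the relation [q * (1 - alpha) = 1] turns the kernel into [2 / (V k i + T k)]. Its
    layer sum over [i] is of order [L k], and the division by [L k] in [f] cancels this. *)
Lemma far_part_le alpha q (I : eqType) (s : seq I) (d : I -> I -> nat)
    (v Y T : I -> R) (W : R) :
  0 < alpha -> alpha < 1 -> q^-1 = 1 - alpha ->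
  (forall i, 0 < v i) -> W = \sum_(i <- s) v i -> 0 < W ->
  (forall k, 1 <= Y k) -> (forall k, T k = W / Y k `^ (2 / alpha)) ->
  \sum_(i <- s) v i * (\sum_(k <- s) v k * (Y k *
    (2 / (\sum_(j <- s | (d k j <= d k i)%N) v j + T k)) `^ (1 - alpha))) `^ q
  <= 4 / alpha * (\sum_(k <- s) v k * Y k * (1 + ln (Y k))) `^ q.
Proof.
move=> alpha0 alpha1 qE v0 WE W0 Y1 TE.
have q1 := conjugate_exponent_gt1 alpha0 alpha1 qE.
have q0 : 0 < q by rewrite (lt_trans ltr01).
have Y0 k : 0 < Y k by exact: lt_le_trans (Y1 k).
have T0 k : 0 < T k by rewrite TE divr_gt0// powR_gt0.
pose L k := 1 + ln (Y k).
have L1 k : 1 <= L k by rewrite lerDl ln_ge0.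
have L0 k : 0 < L k by exact: lt_le_trans (L1 k).
pose V k i := \sum_(j <- s | (d k j <= d k i)%N) v j.
have V0 k i : 0 <= V k i by rewrite sumr_ge0// => j _; rewrite ltW.
have VT k i : 0 < V k i + T k by rewrite ltr_wpDl.
pose a k := v k * Y k * L k.
have a0 k : 0 < a k by rewrite !mulr_gt0.
pose f i k := (2 / (V k i + T k)) `^ (1 - alpha) / L k.
have f0 i k : 0 <= f i k by rewrite divr_ge0 ?powR_ge0// ltW.
rewrite -/(\sum_(k <- s) a k); set B := \sum_(k <- s) a k.
(* Each [a k] is at least [v k], so [B >= W]. *)
have B0 : 0 < B.
  rewrite lt_neqAle sumr_ge0 ?andbT; last by move=> k _; rewrite ltW.
  apply/eqP => B0; suff : W <= B by rewrite -B0 leNgt W0.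
  rewrite WE; apply: ler_sum => k _; rewrite /a -mulrA ler_peMr ?(ltW (v0 k))//.
  by rewrite -[1]mulr1 ler_pM.
(* As [L k >= 1] and [q > 1], the [q]-th power of [1 / L k] may be replaced by [1 / L k]. *)
have fq i k : f i k `^ q <= 2 / L k * (V k i + T k)^-1.
  rewrite /f powRM ?powR_ge0 ?invr_ge0 ?(ltW (L0 k))//.
  rewrite -powRrM -qE mulVf ?gt_eqF// powRr1 ?divr_ge0 ?(ltW (VT k i))//.
  rewrite mulrAC ler_pM2r ?invr_gt0// ler_pM2l//.
  by rewrite ge1r_powR ?(ltW q1)// invr_gt0 L0/= invf_le1 ?L0 ?L1.
have column k : \sum_(i <- s) v i * f i k `^ q <= 4 / alpha.
  apply: (@le_trans _ _ (\sum_(i <- s) 2 / L k * (v i * (V k i + T k)^-1))).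
    by apply: ler_sum => i _; rewrite mulrCA ler_pM2l.
  rewrite -mulr_sumr.
  have := @layer_sum R I s (d k) v (fun b => (b + T k)^-1) (fun b => ln (b + T k)).
  move=> /(_ (fun i => ltW (v0 i)) (fun b c b0 bc => ln_secant b0 bc (T0 k))).
  rewrite -WE add0r -ln_div ?posrE ?addr_gt0//.
  have -> : (W + T k) / T k = 1 + Y k `^ (2 / alpha).
    by rewrite TE; field; rewrite !gt_eqF ?powR_gt0.
  move=> /le_trans/(_ (ln_growth alpha0 alpha1 (Y1 k))) h.
  apply: (@le_trans _ _ (2 / L k * (2 / alpha * L k))).
    by rewrite ler_pM2l// divr_gt0.
  by rewrite le_eqVlt; apply/orP; left; apply/eqP; field; rewrite !gt_eqF.
have row i : (\sum_(k <- s) v k * (Y k * (2 / (V k i + T k)) `^ (1 - alpha))) `^ q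
    <= B `^ (q - 1) * \sum_(k <- s) a k * f i k `^ q.
  have -> : \sum_(k <- s) v k * (Y k * (2 / (V k i + T k)) `^ (1 - alpha)) =
      \sum_(k <- s) a k * f i k.
    by apply: eq_bigr => k _; rewrite /a /f; field; rewrite gt_eqF.
  by apply: powR_Jensen => // k; rewrite ltW.
apply: (@le_trans _ _ (\sum_(i <- s) \sum_(k <- s)
    B `^ (q - 1) * (a k * (v i * f i k `^ q)))).
  apply: ler_sum => i _; rewrite -mulr_sumr.
  apply: (le_trans (ler_wpM2l (ltW (v0 i)) (row i))).
  rewrite mulrCA ler_wpM2l ?powR_ge0// mulr_sumr.
  by apply: ler_sum => k _; rewrite mulrCA.
rewrite exchange_big/=.
apply: (@le_trans _ _ (\sum_(k <- s) B `^ (q - 1) * (a k * (4 / alpha)))).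
  apply: ler_sum => k _; rewrite -mulr_sumr ler_wpM2l ?powR_ge0//.
  by rewrite -mulr_sumr ler_pM2l.
rewrite -mulr_sumr -mulr_suml -/B mulrCA mulrA.
by rewrite mulr_powRB1 ?(ltW B0)// mulrC.
Qed.

(** The exponent [1 - alpha / 2] is below 1, so the singularity is integrable and the antiderivative
    vanishes at 0. *)
Lemma near_part_le alpha (I : eqType) (s : seq I) (d : I -> nat) (v : I -> R) :
  0 < alpha -> alpha < 1 -> (forall i, 0 < v i) ->
  \sum_(k <- s) v k *
    ((\sum_(i <- s) v i) `^ (alpha / 2)
      / (\sum_(j <- s | (d j <= d k)%N) v j) `^ (1 - alpha / 2))
  <= 2 / alpha * (\sum_(i <- s) v i) `^ alpha.
Proof.
move=> alpha0 alpha1 v0; set W := \sum_(i <- s) v i.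
have d0 : 0 < alpha / 2 by rewrite divr_gt0.
have d1 : alpha / 2 < 1 by lra.
have := @layer_sum R I s d v (fun b => (b `^ (1 - alpha / 2))^-1)
  (fun b => b `^ (alpha / 2) / (alpha / 2)) (fun i => ltW (v0 i))
  (fun b c b0 bc => powR_secant b0 bc d0 d1).
rewrite -/W powR0 ?gt_eqF// mul0r subr0 => h.
under eq_bigr do rewrite mulrCA.
rewrite -mulr_sumr (le_trans (ler_wpM2l (powR_ge0 _ _) h))//.
have -> : W `^ alpha = W `^ (alpha / 2) * W `^ (alpha / 2).
  rewrite -powRD; last by rewrite gt_eqF// addr_gt0.
  by congr (_ `^ _); lra.
by rewrite le_eqVlt; apply/orP; left; apply/eqP; field; rewrite gt_eqF.
Qed.

Lemma fractional_LlogL alpha q (I : eqType) (s : seq I) (d : I -> I -> nat)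
    (U : I -> I -> R) (v y : I -> R) (W B : R) :
  0 < alpha -> alpha < 1 -> q^-1 = 1 - alpha ->
  (forall i, 0 < v i) -> (forall i, 0 <= y i) ->
  W = \sum_(i <- s) v i ->
  B = \sum_(k <- s) v k * Num.max 1 (y k) * (1 + ln (Num.max 1 (y k))) ->
  {in s &, forall i k, \sum_(j <- s | (d i j <= d i k)%N) v j <= U i k} ->
  {in s &, forall i k, \sum_(j <- s | (d k j <= d k i)%N) v j <= U i k} ->
  \sum_(i <- s) v i * (\sum_(k <- s) v k * (y k / U i k `^ (1 - alpha))) `^ q
  <= 2 `^ q * ((2 / alpha) `^ q * W `^ q + 4 / alpha * B `^ q).
Proof.
move=> alpha0 alpha1 qE v0 y0 WE BE Ui Uk.
have q1 := conjugate_exponent_gt1 alpha0 alpha1 qE.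
have q0 : 0 < q by rewrite (lt_trans ltr01).
have [s0|s_neq0] := eqVneq s [::].
  rewrite s0 !big_nil mulr_ge0 ?powR_ge0// addr_ge0// ?mulr_ge0 ?powR_ge0//.
  by rewrite invr_ge0 ltW.
have W_ge k : k \in s -> v k <= W.
  move=> ks; rewrite WE (big_rem k)//= lerDl sumr_ge0// => j _; exact: ltW.
have W0 : 0 < W.
  case: s s_neq0 {WE BE Ui Uk} W_ge => // k s _ /(_ k (mem_head _ _)).
  exact: lt_le_trans.
pose Y k := Num.max 1 (y k).
have Y1 k : 1 <= Y k by rewrite le_max lexx.
have yY k : y k <= Y k by rewrite le_max lexx orbT.
pose T k := W / Y k `^ (2 / alpha).
pose F i := \sum_(k <- s) v k * (Y k *
    (2 / (\sum_(j <- s | (d k j <= d k i)%N) v j + T k)) `^ (1 - alpha)).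
have F0 i : 0 <= F i.
  rewrite sumr_ge0// => k _; rewrite !mulr_ge0 ?powR_ge0 ?(ltW (v0 k))//.
  exact: le_trans (Y1 k).
have V0 k i : i \in s -> 0 < \sum_(j <- s | (d k j <= d k i)%N) v j.
  move=> si; rewrite (big_rem i)//= leqnn ltr_pwDl// sumr_ge0// => j _.
  exact: ltW.
have J_le i : i \in s ->
    \sum_(k <- s) v k * (y k / U i k `^ (1 - alpha)) <= 2 / alpha * W `^ alpha + F i.
  move=> si.
  apply: le_trans (_ : _ <= \sum_(k <- s) v k *
      (W `^ (alpha / 2) / (\sum_(j <- s | (d i j <= d i k)%N) v j) `^ (1 - alpha / 2))
      + F i) _; last first.
    by rewrite lerD2r WE; exact: near_part_le.
  rewrite -big_split/= big_seq [leRHS]big_seq; apply: ler_sum => k sk.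
  rewrite -mulrDr ler_pM2l//.
  (* [V'] is the ball around [i], so that the near part is layered in [k]; [V] is the ball around
     [k], so that the far part is layered in [i]. *)
  apply: kernel_split => //; [|exact: ltW (V0 k i si)|exact: Uk|exact: V0|exact: Ui].
  exact: lt_le_trans (V0 i k sk) (Ui i k si sk).
apply: (@le_trans _ _ (2 `^ q *
    \sum_(i <- s) (v i * ((2 / alpha) * W `^ alpha) `^ q + v i * F i `^ q))).
  rewrite mulr_sumr big_seq [leRHS]big_seq; apply: ler_sum => i si.
  rewrite -mulrDr [leRHS]mulrCA ler_pM2l//.
  have c0 : 0 <= 2 / alpha * W `^ alpha by rewrite mulr_ge0 ?powR_ge0 ?divr_ge0 ?(ltW alpha0).
  apply: le_trans (powR_sum2_le c0 (F0 i) (ltW q0)).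
  rewrite ge0_ler_powR ?nnegrE ?(ltW q0) ?addr_ge0 ?J_le//.
  rewrite big_seq sumr_ge0// => k sk.
  by rewrite !mulr_ge0 ?invr_ge0 ?powR_ge0 ?(ltW (v0 k)).
rewrite ler_wpM2l ?powR_ge0// big_split/= lerD//; last first.
  by rewrite BE; exact: (@far_part_le alpha q I s d v Y T W).
(* Since [q * alpha = q - 1], the total mass [W] completes the power of [W] to [q]. *)
rewrite -mulr_suml -WE powRM ?powR_ge0 ?divr_ge0 ?(ltW alpha0)// -powRrM.
rewrite [alpha * q]mulrC (conjugate_exponentE alpha0 alpha1 qE).
by rewrite mulrCA mulr_powRB1 ?(ltW W0).
Qed.

End fractional_LlogL.

(** * Windows, the A(1,q) condition and domination of the operators *)

Section windows.
Context {R : realType}.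
Implicit Types (alpha q : R) (w x : int -> R).

Lemma sumr_le_subset (I : eqType) (s s' : seq I) (P : pred I) (F : I -> R) :
  uniq s -> uniq s' -> (forall i, 0 <= F i) ->
  {in s, forall i, P i -> i \in s'} ->
  \sum_(i <- s | P i) F i <= \sum_(i <- s') F i.
Proof.
move=> us us' F0 sub.
rewrite -big_filter (perm_big [seq i <- s' | i \in [seq i <- s | P i]]).
  rewrite big_filter [leRHS](bigID (fun i => i \in [seq i <- s | P i]))/=.
  by rewrite lerDl sumr_ge0.
apply: uniq_perm; rewrite ?filter_uniq// => i; rewrite [RHS]mem_filter.
apply/esym/andb_idr; rewrite mem_filter => /andP[Pi si]; exact: sub.
Qed.

Lemma mem_window (m k : int) (N : nat) :
  (k \in fset_set (window m N)) = (absz (m - k) <= N)%N.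
Proof.
rewrite in_fset_set; last exact: finite_window.
by apply/idP/idP; rewrite inE /window/=; lia.
Qed.

(** The [q]-th power of the A(1,q) condition, with the supremum of [1 / w] bounded below by its
    value at an arbitrary point [k] of the window. *)
Lemma A1_ball q w : 0 < q -> discrete_weight w -> A1 q w ->
  exists2 A : R, 0 < A & forall (m k : int) (N : nat),
    (absz (m - k) <= N)%N ->
    \sum_(j <- fset_set (window m N)) w j `^ q <=
      A * N.*2.+1%:R * w k `^ q.
Proof.
move=> q0 w0 wA1.
have A1_ge (m k : int) N : (absz (m - k) <= N)%N ->
    (((N.*2.+1%:R^-1 * \sum_(j <- fset_set (window m N)) w j `^ q) `^ q^-1
      * (w k)^-1)%:E <= A1_const q w)%E.
  move=> mk; apply: le_ereal_sup_tmp; eexists; first by exists (m, N).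
  rewrite /= window_cardE fsbig_finite; last exact: finite_window.
  rewrite EFinM lee_wpmul2l ?lee_fin ?powR_ge0//.
  apply: ereal_sup_ubound; exists k => //.
  by rewrite /window/=; lia.
(* The one-point window at 0 already gives a positive value, so the finite supremum is a positive
   real. *)
have A1_gt0 : (0 < A1_const q w)%E.
  apply: lt_le_trans (A1_ge 0 0 0%N _) => //.
  rewrite lte_fin mulr_gt0 ?invr_gt0 ?powR_gt0// mulr_gt0 ?invr_gt0//.
  rewrite (big_rem 0) ?mem_window//= ltr_pwDl ?powR_gt0// sumr_ge0// => j _.
  exact: powR_ge0.
have [c cE] : exists c : R, A1_const q w = c%:E.
  by move: wA1 A1_gt0; rewrite /A1; case: (A1_const q w) => // c _ _; exists c.
move: A1_gt0 A1_ge; rewrite cE lte_fin => c0 A1_ge.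
exists (c `^ q); rewrite ?powR_gt0// => m k N /A1_ge.
rewrite lee_fin ler_pdivrMr// => h.
have n0 : 0 < N.*2.+1%:R :> R by rewrite ltr0n.
have S0 : 0 <= \sum_(j <- fset_set (window m N)) w j `^ q.
  by rewrite sumr_ge0// => j _; exact: powR_ge0.
have : ((N.*2.+1%:R^-1 * \sum_(j <- fset_set (window m N)) w j `^ q) `^ q^-1) `^ q
    <= (c * w k) `^ q.
  by rewrite ge0_ler_powR ?nnegrE ?powR_ge0 ?(ltW q0)// mulr_ge0 ?ltW.
rewrite -powRrM mulVf ?gt_eqF// powRr1; last by rewrite mulr_ge0// invr_ge0 ltW.
rewrite powRM ?(ltW c0) ?(ltW (w0 k))// ler_pdivrMl//.
by rewrite mulrCA mulrA.
Qed.

(* The diagonal term is kept, so that this dominates the maximal function too. *)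
Definition potential alpha x (s : seq int) (k : int) : R :=
  \sum_(i <- s) `|x i| / (absz (k - i)).*2.+1%:R `^ (1 - alpha).

(** A point [i] of the window of radius [n] around [k] has [2|k - i| + 1 <= 2n + 1], so every
    average is dominated term by term. *)
Lemma frac_max_le alpha x (m k : int) (N : nat) :
  0 < alpha -> alpha < 1 -> supported_in x (window m N) ->
  (`|frac_max alpha x k| <= (potential alpha x (fset_set (window m N)) k)%:E)%E.
Proof.
move=> alpha0 alpha1 xS.
rewrite gee0_abs; last first.
  apply: le_ereal_sup_tmp; eexists; first by exists 0%N.
  rewrite lee_fin mulr_ge0 ?invr_ge0 ?powR_ge0// fsbig_finite ?sumr_ge0//.
  exact: finite_window.
apply: ge_ereal_sup => _ [n _ <-]; rewrite lee_fin window_cardE fsbig_finite; last first.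
  exact: finite_window.
have xE : \sum_(i <- fset_set (window k n)) `|x i| =
    \sum_(i <- fset_set (window k n) | i \in fset_set (window m N)) `|x i|.
  rewrite (bigID (fun i => i \in fset_set (window m N)))/= [X in _ + X]big1 ?addr0//.
  move=> i iS; rewrite xS ?normr0//; apply: contraNnot iS.
  by rewrite in_fset_set ?inE//; exact: finite_window.
rewrite xE mulr_sumr; set F := fun i => `|x i| / (absz (k - i)).*2.+1%:R `^ (1 - alpha).
apply: (@le_trans _ _ (\sum_(i <- fset_set (window k n) | i \in fset_set (window m N)) F i)).
  rewrite big_seq_cond [leRHS]big_seq_cond; apply: ler_sum => i /andP[].
  rewrite mem_window => ki _; rewrite mulrC /F ler_wpM2l//.
  rewrite lef_pV2 ?posrE ?powR_gt0 ?ltr0n//.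
  rewrite ge0_ler_powR ?nnegrE ?ler0n ?subr_ge0 ?(ltW alpha1)//.
  by rewrite ler_nat ltnS leq_double.
apply: sumr_le_subset => //; rewrite ?fset_uniq// => i.
by rewrite /F divr_ge0 ?powR_ge0.
Qed.

(** Off the diagonal [2r + 1 <= 3r], and the power [1 - alpha] of 3 is at most 3. *)
Lemma riesz_kernel_le alpha (r : nat) : 0 < alpha -> alpha < 1 -> (0 < r)%N ->
  (r%:R `^ (1 - alpha))^-1 <= 3 * (r.*2.+1%:R `^ (1 - alpha))^-1 :> R.
Proof.
move=> alpha0 alpha1 r0.
rewrite -[3]invrK -invfM lef_pV2 ?posrE ?mulr_gt0 ?invr_gt0 ?powR_gt0 ?ltr0n//.
rewrite ler_pdivrMl//.
apply: (@le_trans _ _ ((3 * r%:R) `^ (1 - alpha))).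
  rewrite ge0_ler_powR ?nnegrE ?mulr_ge0 ?ler0n ?subr_ge0 ?(ltW alpha1)//.
  by rewrite -natrM ler_nat; lia.
rewrite powRM// ler_wpM2r ?powR_ge0//; apply: ler1_powR; lra.
Qed.

Lemma riesz_le alpha x (m k : int) (N : nat) :
  0 < alpha -> alpha < 1 -> supported_in x (window m N) ->
  (`|riesz alpha x k| <=
    (3 * potential alpha x (fset_set (window m N)) k)%:E)%E.
Proof.
move=> alpha0 alpha1 xS; set X := (3 * _)%:E.
pose F i := (3 * (`|x i| / (absz (k - i)).*2.+1%:R `^ (1 - alpha)))%:E.
have F0 i : (0 <= F i)%E by rewrite lee_fin !mulr_ge0 ?invr_ge0 ?powR_ge0.
have esumF : (\esum_(i in window m N) F i = X)%E.
  rewrite esum_fset//; last exact: finite_window.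
  rewrite fsbig_finite; last exact: finite_window.
  by rewrite /F sumEFin -mulr_sumr.
have esum_bound (g : int -> \bar R) :
    (forall i, i != k -> (g i <= `|riesz_term alpha x k i|)%E) ->
    (\esum_(i in ~` [set k]) g i <= X)%E.
  move=> gle; rewrite -esumF esum_mkcond [leRHS]esum_mkcond.
  apply: le_esum => i _; case: ifPn => ik; last by case: ifPn.
  have {}ik : i != k by move: ik; rewrite inE/= => /eqP.
  apply: (le_trans (gle i ik)); case: ifPn => [iS|]; last first.
    by rewrite notin_setE => iS; rewrite /riesz_term xS// mul0r abse0.
  rewrite /riesz_term /F abse_EFin lee_fin normrM normfV.
  rewrite (ger0_norm (powR_ge0 _ _)) mulrCA ler_wpM2l//.
  have -> : `|k - i|%:~R = (absz (k - i))%:R :> R by rewrite -abszE.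
  by apply: riesz_kernel_le => //; lia.
(* The positive and negative sums both lie in [[0, X]] with [X] real, so their difference is well
   defined and costs no factor 2. *)
have bound2 (a b : \bar R) : (0 <= a -> 0 <= b -> a <= X -> b <= X -> `|a - b| <= X)%E.
  move: a b => [a| |] [b| |]// ; rewrite ?lee_fin// => a0 b0 aX bX.
  by rewrite ler_norml; apply/andP; split; lra.
apply: bound2; first by apply: esum_ge0 => i _; exact: funepos_ge0.
- by apply: esum_ge0 => i _; exact: funeneg_ge0.
- apply: esum_bound => i _; rewrite funeposE ge_max lee_abs abse_ge0//.
- apply: esum_bound => i _; rewrite funenegE ge_max abse_ge0 andbT -abseN lee_abs//.
Qed.

End windows.

(** * Transfer to the weighted norms *)

Section weighted_bounds.
Context {R : realType}.
Implicit Types (alpha q : R) (w x : int -> R).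

Lemma weighted_norm_le q w (A : set int) (T : int -> \bar R) (f : int -> R)
    (D : R) :
  0 < q -> finite_set A -> discrete_weight w -> 0 <= D ->
  (forall k, 0 <= f k) -> (forall k, (`|T k| <= (D * f k)%:E)%E) ->
  (weighted_norm q w A T <=
    (D * (\sum_(k <- fset_set A) w k `^ q * f k `^ q) `^ q^-1)%:E)%E.
Proof.
move=> q0 finA w0 D0 f0 Tf; rewrite /weighted_norm fsbig_finite//=.
have term k : (`|T k * (w k)%:E| `^ q <= (D `^ q * (w k `^ q * f k `^ q))%:E)%E.
  have -> : D `^ q * (w k `^ q * f k `^ q) = (D * f k * w k) `^ q.
    by rewrite !powRM ?mulr_ge0 ?(ltW (w0 k))//; ring.
  have h : (`|T k * (w k)%:E| <= (D * f k * w k)%:E)%E.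
    rewrite abseM (gee0_abs (_ : 0 <= (w k)%:E)%E) ?lee_fin ?(ltW (w0 k))//.
    by rewrite EFinM lee_wpmul2r ?lee_fin ?(ltW (w0 k)).
  rewrite -poweR_EFin gt0_ler_poweR ?(ltW q0)//.
    by rewrite in_itv/= abse_ge0 leey.
  by rewrite in_itv/= leey lee_fin !mulr_ge0 ?(ltW (w0 k)).
have S0 : 0 <= \sum_(k <- fset_set A) w k `^ q * f k `^ q.
  by rewrite sumr_ge0// => k _; rewrite mulr_ge0 ?powR_ge0.
have -> : D * (\sum_(k <- fset_set A) w k `^ q * f k `^ q) `^ q^-1 =
    (\sum_(k <- fset_set A) D `^ q * (w k `^ q * f k `^ q)) `^ q^-1.
  rewrite -mulr_sumr powRM ?powR_ge0// -powRrM mulfV ?gt_eqF// powRr1//.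
rewrite -poweR_EFin gt0_ler_poweR ?invr_ge0 ?(ltW q0)//.
- by rewrite in_itv/= leey sume_ge0// => k _; exact: poweR_ge0.
- rewrite in_itv/= leey lee_fin sumr_ge0// => k _.
  by rewrite !mulr_ge0 ?powR_ge0.
- by rewrite -sumEFin; apply: lee_sum => k _; exact: term.
Qed.

(** For [y > 1] this reduces to [y <= 1 + y * ln y], which is [ln (1 / y) <= 1 / y - 1] multiplied
    by [y]. *)
Lemma max1_LlogL_le (y : R) : 0 <= y ->
  Num.max 1 y * (1 + ln (Num.max 1 y)) <= 1 + 2 * (y * logp y).
Proof.
move=> y0; rewrite /logp; have [y1|y1] := ltP 1 y; last first.
  by rewrite ln1 !mulr0 !addr0 mulr1.
have {}y0 : 0 < y by rewrite (lt_trans ltr01).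
have := @le_ln1Dx R (y^-1 - 1).
rewrite ltrBrDl subrr invr_gt0 addrC subrK lnV ?posrE// => /(_ y0).
move=> /(ler_wpM2l (ltW y0)); rewrite mulrBr mulfV ?gt_eqF// mulr1 mulrN.
lra.
Qed.

Lemma potential_LlogL_bound alpha q w :
  0 < alpha -> alpha < 1 -> q^-1 = 1 - alpha ->
  discrete_weight w -> A1 q w ->
  exists2 C : R, 0 < C & forall (m : int) (N : nat) x,
    (\sum_(k <- fset_set (window m N)) w k `^ q
      * potential alpha x (fset_set (window m N)) k `^ q) `^ q^-1
    <= C * (\sum_(k \in window m N) w k `^ q + LlogL q w (window m N) x).
Proof.
move=> alpha0 alpha1 qE w0 wA1.
have q1 := conjugate_exponent_gt1 alpha0 alpha1 qE.
have q0 : 0 < q by rewrite (lt_trans ltr01).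
have a1 : 0 <= 1 - alpha by rewrite subr_ge0 ltW.
have [A A0 ball] := A1_ball q0 w0 wA1.
pose c := (2 / alpha) `^ q + 4 / alpha.
have c0 : 0 < c by rewrite ltr_pwDr ?powR_ge0 ?divr_gt0.
(* The first factor comes from normalising the kernel by [U], the next two from the root of
   [2 ^ q * c], and the last from [W + B <= 2 * (W + LL)]. *)
exists (A `^ (1 - alpha) * (2 * c `^ q^-1 * 2)).
  by rewrite !mulr_gt0 ?powR_gt0.
move=> m N x; set s := fset_set (window m N).
pose v k := w k `^ q.
have v0 k : 0 < v k by exact: powR_gt0.
pose y k : R := `|x k * w k `^ (1 - q)|.
have y0 k : 0 <= y k by exact: normr_ge0.
pose d (i k : int) := absz (i - k).
(* [U] carries the weight at the source [k] only. This suffices for both centres: the balls of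
   radius [|i - k|] around [i] and around [k] each contain [k]. *)
pose U (i k : int) := A * (d i k).*2.+1%:R * v k.
have vy k : v k * y k = `|x k| * w k.
  rewrite /v /y normrM (ger0_norm (powR_ge0 _ _)) mulrCA -powRD; last first.
    by rewrite (gt_eqF (w0 k)) implybT.
  by rewrite subrKC powRr1 ?(ltW (w0 k)).
rewrite fsbig_finite; last exact: finite_window.
rewrite -/s; set W := \sum_(k <- s) w k `^ q.
have -> : LlogL q w (window m N) x = \sum_(k <- s) v k * (y k * logp (y k)).
  rewrite /LlogL fsbig_finite; last exact: finite_window.
  by apply: eq_bigr => k _; rewrite mulrA vy.
set LL := \sum_(k <- s) v k * (y k * logp (y k)).
pose B := \sum_(k <- s) v k * Num.max 1 (y k) * (1 + ln (Num.max 1 (y k))).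
have BLL : B <= W + 2 * LL.
  rewrite mulr_sumr -big_split/=; apply: ler_sum => k _.
  have := ler_wpM2l (ltW (v0 k)) (max1_LlogL_le (y0 k)).
  by rewrite (mulrDr (v k)) mulr1 [v k * (2 * _)]mulrCA (mulrA (v k) (Num.max _ _)).
have W0 : 0 <= W by rewrite sumr_ge0// => k _; exact: powR_ge0.
have B0 : 0 <= B.
  rewrite sumr_ge0// => k _; rewrite !mulr_ge0 ?(ltW (v0 k)) ?le_max ?ler01//.
  by rewrite addr_ge0// ln_ge0// le_max lexx.
have ball_s (i k : int) (l : nat) : (absz (i - k) <= l)%N ->
    \sum_(j <- s | (d i j <= l)%N) v j <= A * l.*2.+1%:R * v k.
  move=> ik; apply: le_trans (ball i k l ik).
  apply: sumr_le_subset; rewrite ?fset_uniq//; first by move=> j; exact: powR_ge0.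
  by move=> j _ ij; rewrite mem_window.
pose inner i := \sum_(k <- s) v k * (y k / U i k `^ (1 - alpha)).
have core := @fractional_LlogL R alpha q int s d U v y W B alpha0 alpha1 qE v0
  y0 erefl erefl (fun i k _ _ => ball_s i k (d i k) (leqnn _)).
have {}core : \sum_(i <- s) v i * inner i `^ q <= 2 `^ q * (c * (W + B) `^ q).
  apply: le_trans (core _) _.
    by move=> i k _ _; rewrite /U /d distnC; apply: ball_s; rewrite subrr.
  rewrite ler_wpM2l ?powR_ge0// /c (mulrDl ((2 / alpha) `^ q)) lerD//.
    rewrite ler_wpM2l ?powR_ge0// ge0_ler_powR ?nnegrE ?addr_ge0 ?(ltW q0)//.
    by rewrite lerDl.
  rewrite ler_wpM2l ?divr_ge0 ?(ltW alpha0)// ge0_ler_powR ?nnegrE ?addr_ge0 ?(ltW q0)//.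
  by rewrite lerDr.
(* The power [1 - alpha] of [v k] is [w k], which cancels the weight in
   [v k * y k = |x k| * w k]. *)
have potE i : potential alpha x s i = A `^ (1 - alpha) * inner i.
  rewrite mulr_sumr; apply: eq_bigr => k _.
  rewrite (mulrA (v k)) vy /U !powRM ?mulr_ge0 ?(ltW A0) ?(ltW (v0 k))//.
  have -> : v k `^ (1 - alpha) = w k.
    by rewrite /v -powRrM -qE mulfV ?gt_eqF// powRr1 ?(ltW (w0 k)).
  have wk := w0 k.
  by field; rewrite !gt_eqF ?powR_gt0 ?ltr0n.
have inner0 i : 0 <= inner i.
  rewrite sumr_ge0// => k _; rewrite mulr_ge0 ?(ltW (v0 k))//.
  by rewrite divr_ge0 ?powR_ge0.
have S0 : 0 <= \sum_(i <- s) v i * inner i `^ q.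
  by rewrite sumr_ge0// => i _; rewrite mulr_ge0 ?powR_ge0.
have -> : \sum_(k <- s) w k `^ q * potential alpha x s k `^ q =
    (A `^ (1 - alpha)) `^ q * \sum_(i <- s) v i * inner i `^ q.
  rewrite mulr_sumr; apply: eq_bigr => i _.
  by rewrite potE powRM ?powR_ge0// mulrCA.
have rootK (t : R) : 0 <= t -> (t `^ q) `^ q^-1 = t.
  by move=> t0; rewrite -powRrM mulfV ?gt_eqF// powRr1.
rewrite powRM ?powR_ge0// rootK ?powR_ge0// -!mulrA ler_wpM2l ?powR_ge0//.
apply: (@le_trans _ _ ((2 `^ q * (c * (W + B) `^ q)) `^ q^-1)).
  rewrite ge0_ler_powR ?nnegrE ?invr_ge0 ?(ltW q0)//.
  by rewrite !mulr_ge0 ?powR_ge0 ?(ltW c0).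
rewrite powRM ?mulr_ge0 ?powR_ge0 ?(ltW c0)// rootK// ler_wpM2l//.
rewrite powRM ?powR_ge0 ?(ltW c0)// rootK ?addr_ge0// ler_wpM2l ?powR_ge0//.
lra.
Qed.

End weighted_bounds.

Theorem theorem4p3 (R : realType) (alpha q : R)
    (alpha_gt0 : 0 < alpha) (alpha_lt1 : alpha < 1)
    (qE : q^-1 = 1 - alpha)
    (w : int -> R) (w_weight : discrete_weight w) (w_A1 : A1 q w)
    (v : int -> R) (vE : forall k, v k = w k `^ q) :
  exists2 C : R, 0 < C &
    forall (m : int) (N : nat) (x : int -> R),
      supported_in x (window m N) ->
      ((LlogL q w (window m N) x)%:E < +oo)%E ->
      (weighted_norm q w (window m N) (frac_max alpha x)
         <= (C * (\sum_(k \in window m N) v k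
                  + LlogL q w (window m N) x))%:E)%E
      /\
      (weighted_norm q w (window m N) (riesz alpha x)
         <= (C * (\sum_(k \in window m N) v k
                  + LlogL q w (window m N) x))%:E)%E.
Proof.
have q0 : 0 < q.
  exact: lt_trans ltr01 (conjugate_exponent_gt1 alpha_gt0 alpha_lt1 qE).
have [C C0 bound] :=
  potential_LlogL_bound alpha_gt0 alpha_lt1 qE w_weight w_A1.
have -> : v = fun k => w k `^ q by apply/funext.
(* The factor 3 is the loss in the Riesz kernel; the maximal function satisfies the same bound a
   fortiori. *)
exists (3 * C); rewrite ?mulr_gt0// => m N x xS _.
have pot0 k : 0 <= potential alpha x (fset_set (window m N)) k.
  by rewrite sumr_ge0// => i _; rewrite divr_ge0 ?powR_ge0.
have norm_le (T : int -> \bar R) :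
    (forall k, (`|T k| <= (3 * potential alpha x (fset_set (window m N)) k)%:E)%E) ->
    (weighted_norm q w (window m N) T <=
      (3 * C * (\sum_(k \in window m N) w k `^ q
                + LlogL q w (window m N) x))%:E)%E.
  move=> /(weighted_norm_le q0 (finite_window m N) w_weight (ler0n _ 3) pot0).
  move=> /le_trans; apply.
  by rewrite lee_fin -mulrA ler_wpM2l.
split; apply: norm_le => k; last exact: riesz_le.
apply: le_trans (frac_max_le k alpha_gt0 alpha_lt1 xS) _.
by rewrite lee_fin ler_peMl// ler1n.
Qed.
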